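(* Let $P:(0,+\infty)\to(0,+\infty)$ be a positive infinitely differentiable function, and let $M$ be the associated normal mean, i.e. $M(x,y)=\frac{xP(x)+yP(y)}{P(x)+P(y)}$ for all $x,y>0$. Then $$Q_M=\frac12\,\frac{P'}{P}.$$
   Context: A mean is a function $M:(0,+\infty)^2\to(0,+\infty)$ of class $C^\infty$ such that $\min(x,y)\le M(x,y)\le\max(x,y)$ and $M(x,y)=M(y,x)$ for all $x,y>0$. The characteristic function of a mean $M$ is $Q_M:(0,+\infty)\to\mathbb{R}$, $Q_M(x):=\frac{\partial^2 M}{\partial x^2}(x,x)$ (second partial derivative with respect to the first variable, evaluated at $(x,x)$). *)

(* Defs.v *)
From Stdlib Require Import Reals Lra Lia.
From Coquelicot Require Import Coquelicot.
Open Scope R_scope.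

(* Functions on (0,+oo) and on (0,+oo)^2 are represented by total functions on
   R and R * R, of which only the values on the open domain matter; derivatives
   at a point of an open domain depend only on these values. *)

Definition smooth_pos (P : R -> R) : Prop :=
  forall n x, 0 < x -> ex_derive_n P n x.

(* [ex_diff_n M n x y]: the iterated partial derivatives of M of order at most
   n exist and are continuous at (x, y). *)
Definition smooth_pos2 (M : R -> R -> R) : Prop :=
  forall n x y, 0 < x -> 0 < y -> ex_diff_n M n x y.

Record mean : Type := Mean {
  mean_fun :> R -> R -> R;
  mean_pos : forall x y, 0 < x -> 0 < y -> 0 < mean_fun x y;
  mean_smooth : smooth_pos2 mean_fun;
  mean_bounds : forall x y, 0 < x -> 0 < y ->
    Rmin x y <= mean_fun x y <= Rmax x y;
  mean_sym : forall x y, 0 < x -> 0 < y -> mean_fun x y = mean_fun y x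
}.

(* [partial_derive 2 0 M x x] is the second partial derivative of M in its
   first variable at (x, x). *)
Definition characteristic_function (M : mean) (x : R) : R :=
  partial_derive 2 0 M x x.

Definition normal_mean_fun (P : R -> R) (x y : R) : R :=
  (x * P x + y * P y) / (P x + P y).

Lemma locally_2d_pos (x y : R) : 0 < x -> 0 < y ->
  locally_2d (fun u v => 0 < u /\ 0 < v) x y.
Proof.
intros Hx Hy.
exists (mkposreal _ (Rmin_pos x y Hx Hy)); simpl; intros u v Hu Hv.
apply Rabs_lt_between in Hu; apply Rabs_lt_between in Hv.
pose proof (Rmin_l x y); pose proof (Rmin_r x y); lra.
Qed.

Lemma ex_diff_n_pos_ext (f g : R -> R -> R) (n : nat) :
  (forall x y, 0 < x -> 0 < y -> f x y = g x y) ->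
  (forall x y, 0 < x -> 0 < y -> ex_diff_n f n x y) ->
  forall x y, 0 < x -> 0 < y -> ex_diff_n g n x y.
Proof.
intros Hfg Hf x y Hx Hy.
apply ex_diff_n_ext_loc with f; [|now apply Hf].
apply locally_2d_impl with (2 := locally_2d_pos x y Hx Hy).
apply locally_2d_forall; intros u v [Hu Hv]; now apply Hfg.
Qed.

Lemma ex_diff_n_pos_S (f f1 f2 : R -> R -> R) (n : nat) :
  (forall x y, 0 < x -> 0 < y -> continuity_2d_pt f x y) ->
  (forall x y, 0 < x -> 0 < y -> is_derive (fun z => f z y) x (f1 x y)) ->
  (forall x y, 0 < x -> 0 < y -> is_derive (fun z => f x z) y (f2 x y)) ->
  (forall x y, 0 < x -> 0 < y -> ex_diff_n f1 n x y) ->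
  (forall x y, 0 < x -> 0 < y -> ex_diff_n f2 n x y) ->
  forall x y, 0 < x -> 0 < y -> ex_diff_n f (S n) x y.
Proof.
intros Hc H1 H2 D1 D2 x y Hx Hy; simpl.
split; [now apply Hc|].
split; [now exists (f1 x y); apply H1|].
split; [now exists (f2 x y); apply H2|].
split.
- apply (ex_diff_n_pos_ext f1); auto.
  intros u v Hu Hv; symmetry; now apply is_derive_unique, H1.
- apply (ex_diff_n_pos_ext f2); auto.
  intros u v Hu Hv; symmetry; now apply is_derive_unique, H2.
Qed.

Lemma smooth_pos2_const (c : R) : smooth_pos2 (fun _ _ => c).
Proof.
intros n; revert c; induction n as [|n IH]; intros c.
- intros x y _ _; split; [apply continuity_2d_pt_const|easy].
- apply ex_diff_n_pos_S with (fun _ _ => 0) (fun _ _ => 0).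
  + intros x y _ _; apply continuity_2d_pt_const.
  + intros x y _ _; apply (is_derive_const (V := R_NormedModule)).
  + intros x y _ _; apply (is_derive_const (V := R_NormedModule)).
  + apply IH.
  + apply IH.
Qed.

Lemma ex_diff_n_pos_plus (n : nat) (f g : R -> R -> R) :
  (forall x y, 0 < x -> 0 < y -> ex_diff_n f n x y) ->
  (forall x y, 0 < x -> 0 < y -> ex_diff_n g n x y) ->
  forall x y, 0 < x -> 0 < y -> ex_diff_n (fun u v => f u v + g u v) n x y.
Proof.
revert f g; induction n as [|n IH]; intros f g Hf Hg.
- intros x y Hx Hy; destruct (Hf x y Hx Hy) as [Cf _].
  destruct (Hg x y Hx Hy) as [Cg _].
  split; [now apply continuity_2d_pt_plus|easy].
- apply ex_diff_n_pos_S with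
    (fun u v => Derive (fun z => f z v) u + Derive (fun z => g z v) u)
    (fun u v => Derive (fun z => f u z) v + Derive (fun z => g u z) v);
  try (apply IH; intros x y Hx Hy; destruct (Hf x y Hx Hy) as (_ & _ & _ & ? & ?);
       destruct (Hg x y Hx Hy) as (_ & _ & _ & ? & ?); assumption);
  intros x y Hx Hy; destruct (Hf x y Hx Hy) as (Cf & Af & Bf & _);
  destruct (Hg x y Hx Hy) as (Cg & Ag & Bg & _).
  + now apply continuity_2d_pt_plus.
  + apply (is_derive_plus (V := R_NormedModule)); now apply Derive_correct.
  + apply (is_derive_plus (V := R_NormedModule)); now apply Derive_correct.
Qed.

Lemma ex_diff_n_pos_mult (n : nat) (f g : R -> R -> R) :
  (forall x y, 0 < x -> 0 < y -> ex_diff_n f n x y) ->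
  (forall x y, 0 < x -> 0 < y -> ex_diff_n g n x y) ->
  forall x y, 0 < x -> 0 < y -> ex_diff_n (fun u v => f u v * g u v) n x y.
Proof.
revert f g; induction n as [|n IH]; intros f g Hf Hg.
- intros x y Hx Hy; destruct (Hf x y Hx Hy) as [Cf _].
  destruct (Hg x y Hx Hy) as [Cg _].
  split; [now apply continuity_2d_pt_mult|easy].
- assert (Hf' : forall x y, 0 < x -> 0 < y -> ex_diff_n f n x y).
  { intros x y Hx Hy; apply ex_diff_n_m with (S n); [lia|now apply Hf]. }
  assert (Hg' : forall x y, 0 < x -> 0 < y -> ex_diff_n g n x y).
  { intros x y Hx Hy; apply ex_diff_n_m with (S n); [lia|now apply Hg]. }
  apply ex_diff_n_pos_S with
    (fun u v => Derive (fun z => f z v) u * g u v + f u v * Derive (fun z => g z v) u)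
    (fun u v => Derive (fun z => f u z) v * g u v + f u v * Derive (fun z => g u z) v);
  try (apply ex_diff_n_pos_plus; apply IH; trivial; intros x y Hx Hy;
       destruct (Hf x y Hx Hy) as (_ & _ & _ & ? & ?);
       destruct (Hg x y Hx Hy) as (_ & _ & _ & ? & ?); assumption);
  intros x y Hx Hy; destruct (Hf x y Hx Hy) as (Cf & Af & Bf & _);
  destruct (Hg x y Hx Hy) as (Cg & Ag & Bg & _).
  + now apply continuity_2d_pt_mult.
  + apply (is_derive_mult (K := R_AbsRing) (fun z => f z y) (fun z => g z y));
      try (now apply Derive_correct); intros; apply Rmult_comm.
  + apply (is_derive_mult (K := R_AbsRing) (fun z => f x z) (fun z => g x z));
      try (now apply Derive_correct); intros; apply Rmult_comm.
Qed.

Lemma ex_diff_n_pos_inv (n : nat) (f : R -> R -> R) :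
  (forall x y, 0 < x -> 0 < y -> f x y <> 0) ->
  (forall x y, 0 < x -> 0 < y -> ex_diff_n f n x y) ->
  forall x y, 0 < x -> 0 < y -> ex_diff_n (fun u v => / f u v) n x y.
Proof.
intros Hf0; induction n as [|n IH]; intros Hf.
- intros x y Hx Hy; destruct (Hf x y Hx Hy) as [Cf _].
  split; [apply continuity_2d_pt_inv; auto|easy].
- assert (Hi : forall x y, 0 < x -> 0 < y -> ex_diff_n (fun u v => / f u v) n x y).
  { apply IH; intros x y Hx Hy; apply ex_diff_n_m with (S n); [lia|now apply Hf]. }
  apply ex_diff_n_pos_S with
    (fun u v => Derive (fun z => f z v) u * (-1 * (/ f u v * / f u v)))
    (fun u v => Derive (fun z => f u z) v * (-1 * (/ f u v * / f u v)));
  try (apply ex_diff_n_pos_mult;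
       [intros x y Hx Hy; destruct (Hf x y Hx Hy) as (_ & _ & _ & ? & ?); assumption
       |apply ex_diff_n_pos_mult; [apply smooth_pos2_const|];
        now apply ex_diff_n_pos_mult]);
  intros x y Hx Hy; destruct (Hf x y Hx Hy) as (Cf & Af & Bf & _);
  pose proof (Hf0 x y Hx Hy) as Hn.
  + now apply continuity_2d_pt_inv.
  + replace (_ * _) with (- Derive (fun z => f z y) x / f x y ^ 2) by now field.
    apply (is_derive_inv (fun z => f z y)); [now apply Derive_correct|easy].
  + replace (_ * _) with (- Derive (fun z => f x z) y / f x y ^ 2) by now field.
    apply (is_derive_inv (fun z => f x z)); [now apply Derive_correct|easy].
Qed.

Lemma smooth_pos_Derive (P : R -> R) : smooth_pos P -> smooth_pos (Derive P).
Proof.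
intros HP n x Hx; destruct n as [|n]; [easy|].
apply ex_derive_ext with (Derive_n P (S n)); [|now apply (HP (S (S n)))].
intros t; change (Derive P) with (Derive_n P 1); rewrite Derive_n_comp.
f_equal; lia.
Qed.

Lemma smooth_pos_derive (P : R -> R) (x : R) :
  smooth_pos P -> 0 < x -> is_derive P x (Derive P x).
Proof. intros HP Hx; apply Derive_correct; now apply (HP 1%nat). Qed.

Lemma smooth_pos_continuity_pt (P : R -> R) (x : R) :
  smooth_pos P -> 0 < x -> continuity_pt P x.
Proof.
intros HP Hx; apply derivable_continuous_pt.
exists (Derive P x); now apply is_derive_Reals, smooth_pos_derive.
Qed.

Lemma smooth_pos2_fst (P : R -> R) : smooth_pos P -> smooth_pos2 (fun x _ => P x).
Proof.
intros HP n; revert P HP; induction n as [|n IH]; intros P HP.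
- intros x y Hx Hy; split; [|easy].
  apply (continuity_1d_2d_pt_comp P (fun u _ => u)).
  + now apply smooth_pos_continuity_pt.
  + apply continuity_2d_pt_id1.
- apply ex_diff_n_pos_S with (fun u _ => Derive P u) (fun _ _ => 0).
  + intros x y Hx Hy; apply (continuity_1d_2d_pt_comp P (fun u _ => u)).
    * now apply smooth_pos_continuity_pt.
    * apply continuity_2d_pt_id1.
  + intros x y Hx _; now apply smooth_pos_derive.
  + intros x y _ _; apply (is_derive_const (V := R_NormedModule)).
  + now apply IH, smooth_pos_Derive.
  + apply smooth_pos2_const.
Qed.

Lemma smooth_pos2_snd (P : R -> R) : smooth_pos P -> smooth_pos2 (fun _ y => P y).
Proof.
intros HP n; revert P HP; induction n as [|n IH]; intros P HP.
- intros x y Hx Hy; split; [|easy].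
  apply (continuity_1d_2d_pt_comp P (fun _ v => v)).
  + now apply smooth_pos_continuity_pt.
  + apply continuity_2d_pt_id2.
- apply ex_diff_n_pos_S with (fun _ _ => 0) (fun _ v => Derive P v).
  + intros x y Hx Hy; apply (continuity_1d_2d_pt_comp P (fun _ v => v)).
    * now apply smooth_pos_continuity_pt.
    * apply continuity_2d_pt_id2.
  + intros x y _ _; apply (is_derive_const (V := R_NormedModule)).
  + intros x y _ Hy; now apply smooth_pos_derive.
  + apply smooth_pos2_const.
  + now apply IH, smooth_pos_Derive.
Qed.

Lemma smooth_pos_id : smooth_pos (fun x => x).
Proof.
intros n x _; apply ex_derive_n_ext with (fun t => t ^ 1).
- intros t; apply pow_1.
- apply ex_derive_n_pow.
Qed.

Lemma normal_mean_smooth (P : R -> R) (Ppos : forall x, 0 < x -> 0 < P x)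
  (Psmooth : smooth_pos P) : smooth_pos2 (normal_mean_fun P).
Proof.
intros n; unfold normal_mean_fun, Rdiv.
apply ex_diff_n_pos_mult.
- apply ex_diff_n_pos_plus; apply ex_diff_n_pos_mult.
  + apply (smooth_pos2_fst (fun x => x)), smooth_pos_id.
  + now apply smooth_pos2_fst.
  + apply (smooth_pos2_snd (fun x => x)), smooth_pos_id.
  + now apply smooth_pos2_snd.
- apply ex_diff_n_pos_inv.
  + intros x y Hx Hy; pose proof (Ppos x Hx); pose proof (Ppos y Hy); lra.
  + apply ex_diff_n_pos_plus; [now apply smooth_pos2_fst|now apply smooth_pos2_snd].
Qed.

Lemma normal_mean_bounds (P : R -> R) (Ppos : forall x, 0 < x -> 0 < P x)
  (x y : R) : 0 < x -> 0 < y ->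
  Rmin x y <= normal_mean_fun P x y <= Rmax x y.
Proof.
intros Hx Hy; unfold normal_mean_fun.
pose proof (Ppos x Hx) as Px; pose proof (Ppos y Hy) as Py.
pose proof (Rmin_l x y); pose proof (Rmin_r x y).
pose proof (Rmax_l x y); pose proof (Rmax_r x y).
split.
- apply Rle_div_r; [lra|nra].
- apply Rle_div_l; [lra|nra].
Qed.

Lemma normal_mean_pos (P : R -> R) (Ppos : forall x, 0 < x -> 0 < P x)
  (x y : R) : 0 < x -> 0 < y -> 0 < normal_mean_fun P x y.
Proof.
intros Hx Hy; apply Rlt_le_trans with (Rmin x y).
- now apply Rmin_pos.
- now apply normal_mean_bounds.
Qed.

Lemma normal_mean_sym (P : R -> R) (x y : R) : 0 < x -> 0 < y ->
  normal_mean_fun P x y = normal_mean_fun P y x.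
Proof.
intros _ _; unfold normal_mean_fun.
now rewrite (Rplus_comm (x * P x)), (Rplus_comm (P x)).
Qed.

Definition normal_mean (P : R -> R) (Ppos : forall x, 0 < x -> 0 < P x)
  (Psmooth : smooth_pos P) : mean :=
  Mean (normal_mean_fun P) (normal_mean_pos P Ppos)
    (normal_mean_smooth P Ppos Psmooth) (normal_mean_bounds P Ppos)
    (normal_mean_sym P).

(* Main.v *)
Require Import Defs.
From Stdlib Require Import Reals Lra.
From Coquelicot Require Import Coquelicot.
Open Scope R_scope.

(** With the weight [w z = P z / (P z + P y)] of the first variable, the normal
    mean reads [M(z, y) = y + (z - y) * w z].  The factor [z - y] vanishes at
    the diagonal point [z = y], so by Leibniz's rule the second derivative of
    [z |-> M(z, y)] there is just [2 * w' y]
    ([Derive_n_2_affine_weight]).  Finally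
    [w' z = P' z * P y / (P z + P y)^2] ([is_derive_weight]), which is
    [P' y / (4 * P y)] at [z = y]; doubling it gives the formula. *)

Lemma locally_pos (x : R) : 0 < x -> locally x (fun z => 0 < z).
Proof. intros Hx; exact (open_gt 0 x Hx). Qed.

(** In the Leibniz expansion of the second derivative of [(z - c) * w z], the
    term [(z - c) * w''] is zero at [c] and [(z - c)'' * w] is zero everywhere,
    so only the cross term remains. *)
Lemma Derive_n_2_affine_weight (w : R -> R) (c : R) :
  locally c (fun z => ex_derive w z) -> ex_derive (Derive w) c ->
  Derive_n (fun z => c + (z - c) * w z) 2 c = 2 * Derive w c.
Proof.
intros Hw Hw'; simpl.
rewrite (Derive_ext_loc _ (fun z => w z + (z - c) * Derive w z)).
- apply is_derive_unique; auto_derive.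
  + split; [now apply locally_singleton|easy].
  + change (fun x => w x) with w; ring.
- apply filter_imp with (2 := Hw); intros z Hz.
  apply is_derive_unique; auto_derive; [easy|].
  change (fun x => w x) with w; ring.
Qed.

Lemma is_derive_weight (P : R -> R) (b z : R) :
  ex_derive P z -> P z + b <> 0 ->
  is_derive (fun t => P t / (P t + b)) z (Derive P z * b / (P z + b) ^ 2).
Proof.
intros HP Hn; auto_derive; [easy|].
change (fun x => P x) with P; now field.
Qed.

Theorem proposition3p4 (P : R -> R)
  (Ppos : forall x : R, 0 < x -> 0 < P x)
  (Psmooth : smooth_pos P) :
  forall x : R, 0 < x ->
    characteristic_function (normal_mean P Ppos Psmooth) x
      = 1 / 2 * (Derive P x / P x).
Proof.
intros x Hx; pose proof (Ppos x Hx) as Px.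
set (w := fun z => P z / (P z + P x)).
assert (Hw : forall z, 0 < z ->
  is_derive w z (Derive P z * P x / (P z + P x) ^ 2)).
{ intros z Hz; pose proof (Ppos z Hz).
  apply is_derive_weight; [now apply (Psmooth 1%nat)|lra]. }
change (Derive_n (fun z => normal_mean_fun P z x) 2 x
        = 1 / 2 * (Derive P x / P x)).
rewrite (Derive_n_ext_loc _ (fun z => x + (z - x) * w z)).
- rewrite Derive_n_2_affine_weight.
  + rewrite (is_derive_unique _ _ _ (Hw x Hx)); field; lra.
  + apply filter_imp with (2 := locally_pos x Hx); intros z Hz.
    eexists; now apply Hw.
  + apply ex_derive_ext_loc with (fun z => Derive P z * P x / (P z + P x) ^ 2).
    * apply filter_imp with (2 := locally_pos x Hx); intros z Hz.
      symmetry; now apply is_derive_unique, Hw.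
    * assert (ex_derive P x) by now apply (Psmooth 1%nat).
      assert (ex_derive (Derive P) x) by now apply (Psmooth 2%nat).
      auto_derive; repeat split; trivial.
      apply Rgt_not_eq; nra.
- apply filter_imp with (2 := locally_pos x Hx); intros z Hz.
  pose proof (Ppos z Hz); unfold normal_mean_fun, w; field; lra.
Qed.
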